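(* For a partition $\lambda$, the crystal skeleton $\mathsf{CS}(\lambda)$ is strongly connected if and only if $\lambda=(w^\ell)$ is a rectangle (all parts equal).
   Context: French notation; $|\lambda|=N$; $\mathsf{SYT}(\lambda)$ standard tableaux; $\mathsf{SSYT}(\lambda)_n$ semistandard tableaux with entries in $[n]$; $\mathsf{row}(b)$ reads rows left to right from the top row to the bottom row; $\mathsf{std}(b)$ replaces the $a_j$ entries $j$, in reading order, by $a_1+\dots+a_{j-1}+1,\dots,a_1+\dots+a_j$. The crystal $B(\lambda)_n$ is $\mathsf{SSYT}(\lambda)_n$ with operators $f_i$ ($1\le i<n$): in the subword of $\mathsf{row}(b)$ of letters $i,i+1$, bracket each $i+1$ with an unbracketed $i$ to its right (parenthesis matching); the unbracketed letters form $i^r(i+1)^s$ and $f_i$ changes the rightmost unbracketed $i$ to $i+1$ ($\emptyset$ if $r=0$). Fix $n\ge N$. The crystal skeleton $\mathsf{CS}(\lambda)$ is the directed graph on $\mathsf{SYT}(\lambda)$ with an edge $T\to T'$ ($T\ne T'$) whenever there are $b,b'\in B(\lambda)_n$ with $\mathsf{std}(b)=T$, $\mathsf{std}(b')=T'$ and $f_i(b)=b'$ for some $i$. A directed graph is strongly connected if any vertex can be reached from any other by a directed path. *)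

(* Defs.v *)
From Stdlib Require Import Relations.
From mathcomp Require Import all_boot.
Set Implicit Arguments. Unset Strict Implicit. Unset Printing Implicit Defensive.

Definition is_partition (la : seq nat) : bool :=
  sorted geq la && all (fun x => 0 < x) la.

(* Tableaux in French notation: t = [:: row1; row2; ...], row1 is the bottom
   (longest) row; rows read left to right. *)
Definition shape (t : seq (seq nat)) : seq nat := map size t.

Definition ss_cond (t : seq (seq nat)) : bool :=
  all (fun r => sorted leq r) t &&
  all (fun i => all (fun j => nth 0 (nth [::] t i) j < nth 0 (nth [::] t i.+1) j)
                    (iota 0 (size (nth [::] t i.+1))))
      (iota 0 (size t).-1).

Definition is_SSYT (la : seq nat) (n : nat) (t : seq (seq nat)) : bool :=
  (shape t == la) && ss_cond t && all (fun x => 0 < x <= n) (flatten t).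

Definition is_SYT (la : seq nat) (t : seq (seq nat)) : bool :=
  (shape t == la) && ss_cond t && perm_eq (flatten t) (iota 1 (sumn la)).

Definition row_word (t : seq (seq nat)) : seq nat := flatten (rev t).

Definition of_word (sh : seq nat) (w : seq nat) : seq (seq nat) :=
  rev (reshape (rev sh) w).

Definition std_word (w : seq nat) : seq nat :=
  [seq (count (fun y => y < nth 0 w p) w
        + count (pred1 (nth 0 w p)) (take p w)).+1 | p <- iota 0 (size w)].

Definition std (t : seq (seq nat)) : seq (seq nat) :=
  of_word (shape t) (std_word (row_word t)).

(* position of the rightmost unbracketed i (each i+1 is bracketed with an
   unbracketed i to its right), scanning left to right; k = number of
   currently unbracketed (i+1)'s, pos = current position. *)
Fixpoint fpos_aux (i : nat) (w : seq nat) (k pos : nat) (acc : option nat)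
  : option nat :=
  match w with
  | [::] => acc
  | x :: w' =>
    if x == i.+1 then fpos_aux i w' k.+1 pos.+1 acc
    else if x == i then
      (if k is k'.+1 then fpos_aux i w' k' pos.+1 acc
       else fpos_aux i w' 0 pos.+1 (Some pos))
    else fpos_aux i w' k pos.+1 acc
  end.

Definition f_word (i : nat) (w : seq nat) : option (seq nat) :=
  match fpos_aux i w 0 0 None with
  | Some p => Some (set_nth 0 w p i.+1)
  | None => None
  end.

Definition f_tab (i : nat) (t : seq (seq nat)) : option (seq (seq nat)) :=
  match f_word i (row_word t) with
  | Some w => Some (of_word (shape t) w)
  | None => None
  end.

Definition CS_edge (la : seq nat) (n : nat) (T T' : seq (seq nat)) : Prop :=
  T <> T' /\
  exists b b' i, [/\ is_SSYT la n b, is_SSYT la n b', (1 <= i < n)%N,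
                     f_tab i b = Some b' & std b = T /\ std b' = T'].

Definition CS_strongly_connected (la : seq nat) (n : nat) : Prop :=
  forall T T', is_SYT la T -> is_SYT la T' ->
    clos_refl_trans (seq (seq nat)) (CS_edge la n) T T'.

(* Main.v *)
(** In one direction, let [N] be the size of the shape and follow the cell of the
    entry [N], which in the standardization of [b] is the last occurrence, in
    reading order, of the largest entry of [b].  When [f_i] changes an [i] into
    [i+1] this position can only move later in reading order, so it never moves
    to a higher corner.  If the shape is not a rectangle it has at least two
    corners, and a tableau with [N] in the top row is not reachable from one
    with [N] in a lower corner.

    In the other direction, applying the operators [f_i] as long as possible
    leads to the lowest weight element, and for a rectangle its rows are constant
    with consecutive values.  Rotating by a half turn and complementing the entries
    reverses the crystal, so every element is also reachable from the highest
    weight element, whose rows are constant as well.  The two extreme elements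
    differ by a shift of all entries and hence have the same standardization, so
    every standard tableau lies on a closed walk through that one vertex. *)
From Stdlib Require Import Relations.
From mathcomp Require Import all_boot zify.
Require Import Defs.

(** * Bracketing *)

(* An [i.+1] is an opening and an [i] a closing parenthesis: [suffix_closed i s]
   says that every [i.+1] in [s] is bracketed within [s], and [prefix_closed i t]
   that every [i] in [t] is. *)
Definition suffix_closed (i : nat) (s : seq nat) : Prop :=
  forall j, count_mem i.+1 (drop j s) <= count_mem i (drop j s).

Definition prefix_closed (i : nat) (t : seq nat) : Prop :=
  forall j, count_mem i (take j t) <= count_mem i.+1 (take j t).

(** The displayed [i] is the rightmost unbracketed one: [s] leaves no [i.+1] over to match it, and
    each [i] in [t] has its partner inside [t]. Unlike the scan [fpos_aux], this form is visibly
    compatible with duality. *)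
Definition f_rel (i : nat) (w w' : seq nat) : Prop :=
  exists s t, [/\ w = s ++ i :: t, w' = s ++ i.+1 :: t,
                  suffix_closed i s & prefix_closed i t].

(** Each [i] met by the scan finds a pending opening, so the accumulator is never overwritten. *)
Lemma fpos_aux_prefix_closed i t k pos acc :
  (forall j, count_mem i (take j t) <= k + count_mem i.+1 (take j t)) ->
  fpos_aux i t k pos acc = acc.
Proof.
elim: t k pos acc => [|x t IH] k pos acc H //=.
have HS j : (x == i) + count_mem i (take j t)
    <= k + ((x == i.+1) + count_mem i.+1 (take j t)) := H j.+1.
have H1 := HS 0; rewrite take0 /= in H1.
have [Ex|Nx] := eqVneq x i.+1.
  by apply: IH => j; move: (HS j); rewrite Ex; lia.
have [Ex|Nx'] := eqVneq x i; last first.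
  by apply: IH => j; move: (HS j); lia.
case: k {H} H1 HS => [|k] H1 HS; first by lia.
by apply: IH => j; move: (HS j); lia.
Qed.

(** After every point of [s] enough closing letters remain to use up all openings, so the scan
    enters [r] with counter 0. *)
Lemma fpos_aux_suffix_closed i s r k pos acc :
  suffix_closed i s -> k + count_mem i.+1 s <= count_mem i s ->
  exists acc', fpos_aux i (s ++ r) k pos acc =
               fpos_aux i r 0 (pos + size s) acc'.
Proof.
elim: s k pos acc => [|x s IH] k pos acc Hs Hk.
  by exists acc; rewrite addn0; have -> : k = 0 by move: Hk => /=; lia.
have {}Hk : k + ((x == i.+1) + count_mem i.+1 s)
    <= (x == i) + count_mem i s := Hk.
rewrite [size _]/= cat_cons /=.
have {}Hs : suffix_closed i s by move=> j; have := Hs j.+1.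
have H0 := Hs 0; rewrite drop0 in H0.
have -> : pos + (size s).+1 = pos.+1 + size s by lia.
have [Ex|Nx] := eqVneq x i.+1; first by apply: IH => //; lia.
have [Ex|Nx'] := eqVneq x i; last by apply: IH => //; lia.
by case: k Hk => [|k] Hk; apply: IH => //; lia.
Qed.

Lemma set_nth_cat_cons (T : Type) (x0 : T) (s t : seq T) x y :
  set_nth x0 (s ++ x :: t) (size s) y = s ++ y :: t.
Proof. by elim: s => //= z s ->. Qed.

Lemma f_rel_word i w w' : f_rel i w w' -> f_word i w = Some w'.
Proof.
case=> s [t [-> -> Hs Ht]]; rewrite /f_word.
have H0 := Hs 0; rewrite drop0 in H0.
have [acc ->] := @fpos_aux_suffix_closed i s (i :: t) 0 0 None Hs H0.
rewrite /= eqxx ifF; last by lia.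
by rewrite fpos_aux_prefix_closed // add0n set_nth_cat_cons.
Qed.

Lemma prefix_closed_rcons i t x :
  prefix_closed i t ->
  (x == i) + count_mem i t <= (x == i.+1) + count_mem i.+1 t ->
  prefix_closed i (rcons t x).
Proof.
move=> Ht Hx j; rewrite -cats1 take_cat; case: ltnP => Hj; first exact: Ht.
case: (j - size t) => [|m].
  by rewrite cats0; have := Ht (size t); rewrite take_size.
rewrite take_oversize // !count_cat.
rewrite -[count_mem i [:: x]]/((x == i) + 0).
by rewrite -[count_mem i.+1 [:: x]]/((x == i.+1) + 0); lia.
Qed.

Lemma balanced_suffix_closed i t :
  prefix_closed i t -> count_mem i.+1 t <= count_mem i t -> suffix_closed i t.
Proof.
move=> Ht H j; have := Ht j; move: H.
by rewrite -[in X in X -> _](cat_take_drop j t) !count_cat; lia.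
Qed.

Lemma suffix_closed_cat i s t :
  suffix_closed i s -> suffix_closed i t -> suffix_closed i (s ++ t).
Proof.
move=> Hs Ht j; rewrite drop_cat; case: ltnP => _; last exact: Ht.
by rewrite !count_cat leq_add //; have := Ht 0; rewrite drop0.
Qed.

(** Induction from the right. An appended letter either leaves the final segment prefix closed or is
    an [i] in excess, and then this [i] becomes the letter to change. *)
Lemma f_rel_or_prefix_closed i w :
  prefix_closed i w \/ exists w', f_rel i w w'.
Proof.
elim/last_ind: w => [|w x [Hw|[w' [s [t [-> _ Hs Ht]]]]]]; first by left.
- case: (leqP ((x == i) + count_mem i w) ((x == i.+1) + count_mem i.+1 w)) => H.
    by left; apply: prefix_closed_rcons.
  have H0 := Hw (size w); rewrite take_size in H0.
  right; exists (rcons w i.+1), w, [::]; rewrite !cats1.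
  have -> : x = i by lia.
  by split=> //; apply: balanced_suffix_closed => //; lia.
- right.
  case: (leqP ((x == i) + count_mem i t) ((x == i.+1) + count_mem i.+1 t)) => H.
    exists (s ++ i.+1 :: rcons t x), s, (rcons t x).
    by rewrite rcons_cat; split=> //; apply: prefix_closed_rcons.
  have H0 := Ht (size t); rewrite take_size in H0.
  exists (rcons (s ++ i :: t) i.+1), (s ++ i :: t), [::]; rewrite !cats1.
  have -> : x = i by lia.
  (* The new left part splits into [s], the single letter [i] and the balanced [t], each of them
     suffix closed. *)
  split=> //; apply: suffix_closed_cat => //.
  rewrite -cat1s; apply: suffix_closed_cat; last first.
    by apply: balanced_suffix_closed => //; lia.
  by move=> [|j] //=; rewrite eqxx; case: eqP.
Qed.

Lemma f_wordP i w w' : f_word i w = Some w' <-> f_rel i w w'.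
Proof.
split; last exact: f_rel_word.
case: (f_rel_or_prefix_closed i w) => [Hw|[v Hv]].
  by rewrite /f_word fpos_aux_prefix_closed.
by rewrite (f_rel_word _ _ _ Hv) => -[<-].
Qed.

(** * Reading words and shapes *)

Lemma of_word_row_word t : of_word (shape t) (row_word t) = t.
Proof. by rewrite /of_word /row_word /shape -map_rev flattenK revK. Qed.

Lemma row_word_of_word sh w : size w = sumn sh -> row_word (of_word sh w) = w.
Proof.
by move=> Hw; rewrite /row_word /of_word revK reshapeKr // sumn_rev Hw.
Qed.

Lemma shape_of_word sh w : size w = sumn sh -> shape (of_word sh w) = sh.
Proof.
move=> Hw; rewrite /shape /of_word map_rev.
by rewrite -[map size _]/(seq.shape _) reshapeKl ?revK // sumn_rev Hw.
Qed.

Lemma size_row_word t : size (row_word t) = sumn (shape t).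
Proof. by rewrite /row_word size_flatten /seq.shape map_rev sumn_rev. Qed.

Lemma size_std_word w : size (std_word w) = size w.
Proof. by rewrite size_map size_iota. Qed.

Lemma row_word_std t : row_word (std t) = std_word (row_word t).
Proof. by rewrite row_word_of_word // size_std_word size_row_word. Qed.

Lemma f_rel_size i w w' : f_rel i w w' -> size w' = size w.
Proof. by case=> s [t [-> -> _ _]]; rewrite !size_cat. Qed.

Lemma f_tabP i t t' :
  f_tab i t = Some t' <->
  shape t' = shape t /\ f_rel i (row_word t) (row_word t').
Proof.
rewrite /f_tab; split=> [|[Hsh Hf]]; last first.
  by rewrite (f_rel_word _ _ _ Hf) -Hsh of_word_row_word.
case E: f_word => [w|] // [<-]; have /f_wordP Hf := E.
have Hw : size w = sumn (shape t) by rewrite (f_rel_size _ _ _ Hf) size_row_word.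
by rewrite shape_of_word // row_word_of_word.
Qed.

(** * The cell of the largest entry *)

Definition below (r r' : seq nat) : bool :=
  all (fun j => nth 0 r j < nth 0 r' j) (iota 0 (size r')).

Lemma belowP r r' :
  reflect (forall j, j < size r' -> nth 0 r j < nth 0 r' j) (below r r').
Proof.
apply: (iffP allP) => H j; last by rewrite mem_iota => /H.
by move=> Hj; apply: H; rewrite mem_iota.
Qed.

Lemma ss_condE t : ss_cond t = all (sorted leq) t && sorted below t.
Proof.
congr (_ && _); apply/allP/(sortedP [::]) => H i Hi.
  by apply: H; rewrite mem_iota /=; lia.
by apply: H; move: Hi; rewrite mem_iota /=; lia.
Qed.

Definition last_max (w : seq nat) (p : nat) : Prop :=
  [/\ p < size w, forall q, q < size w -> nth 0 w q <= nth 0 w p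
    & forall q, p < q < size w -> nth 0 w q < nth 0 w p].

Lemma std_word_last_max w p :
  p < size w -> nth 0 (std_word w) p = size w <-> last_max w p.
Proof.
move=> Hp; rewrite (nth_map 0) ?size_iota // nth_iota // add0n.
set x := nth 0 w p.
have Ew : w = take p w ++ x :: drop p.+1 w by rewrite -drop_nth // cat_take_drop.
have Hlt : count (fun y => y < x) w =
    count (fun y => y < x) (take p w) + count (fun y => y < x) (drop p.+1 w).
  by rewrite [in LHS]Ew count_cat /= ltnn.
have Hsz : size w = p + (size (drop p.+1 w)).+1.
  by rewrite [in LHS]Ew size_cat size_take Hp.
have Hle : count (fun y => y < x) (take p w) + count_mem x (take p w) =
    count (fun y => y <= x) (take p w).
  rewrite -count_predUI [count (predI _ _) _](eq_count (a2 := pred0)).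
    rewrite count_pred0 addn0; apply: eq_count => y /=; lia.
  by move=> y /=; lia.
have H1 := count_size (fun y => y <= x) (take p w).
have H2 := count_size (fun y => y < x) (drop p.+1 w).
have Htp := size_takel (ltnW Hp); rewrite Htp in H1.
(* The label at [p] is one more than the number of letters at most [x] before [p] plus the number of
   letters less than [x] after [p]. It equals [size w] exactly when both counts are full. *)
transitivity (all (fun y => y <= x) (take p w) &&
              all (fun y => y < x) (drop p.+1 w)).
  by rewrite !all_count Htp; split; lia.
split=> [/andP [/allP Htake /allP Hdrop]|[_ Hmax Hlast]].
  have Hgt q : p < q < size w -> nth 0 w q < x.
    move=> Hq; apply: Hdrop.
    have -> : q = p.+1 + (q - p.+1) by lia.
    by rewrite -nth_drop mem_nth // size_drop /=; lia.
  split=> // q Hq; case: (ltngtP q p) => [Hqp|Hpq|-> //].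
    by apply: Htake; rewrite -(nth_take 0 Hqp) mem_nth // Htp.
  by apply/ltnW/Hgt; rewrite Hpq.
apply/andP; split; apply/(all_nthP 0) => q; rewrite ?Htp ?size_drop => Hq.
  by rewrite nth_take //; apply: Hmax; lia.
by rewrite nth_drop; apply: Hlast; lia.
Qed.

Lemma last_max_exists w : 0 < size w -> exists p, last_max w p.
Proof.
elim/last_ind: w => // w x IH _; case: (posnP (size w)) => [/size0nil ->|/IH].
  by exists 0; split=> // q /= Hq; [have -> : q = 0 by lia|lia].
move=> [p [Hp Hmax Hlast]]; case: (leqP (nth 0 w p) x) => Hx.
  exists (size w); split=> [|q|q]; rewrite size_rcons // => Hq; last by lia.
  rewrite !nth_rcons ltnn eqxx; case: ltnP => Hq'; last by case: eqP.
  by apply: leq_trans Hx; apply: Hmax.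
exists p; split=> [|q|q]; rewrite size_rcons; first by lia.
  move=> Hq; rewrite !nth_rcons Hp; case: ltnP => Hq'; first exact: Hmax.
  by case: eqP => // _; apply: ltnW.
move=> Hq; rewrite !nth_rcons Hp; case: (ltnP q) => Hq'; first by apply: Hlast; lia.
by case: eqP => // _; lia.
Qed.

Lemma last_max_index w : 0 < size w -> last_max w (index (size w) (std_word w)).
Proof.
move=> Hw; have [p Hp] := last_max_exists w Hw.
have Hpw : p < size w by case: Hp.
have Hin : size w \in std_word w.
  by rewrite -((std_word_last_max w p Hpw).2 Hp) mem_nth // size_std_word.
apply/std_word_last_max; last by rewrite nth_index.
by rewrite -[X in _ < X]size_std_word index_mem.
Qed.

(** If the position moved earlier, the changed letter would be the new maximum [i.+1] and the old
    last maximum an [i] to its right. That [i] is bracketed with an [i.+1] in [t], which exceeds the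
    maximum of [w]. *)
Lemma f_rel_last_max i w w' p p' :
  f_rel i w w' -> last_max w p -> last_max w' p' -> p <= p'.
Proof.
case=> s [t [Ew Ew' _ Ht]] [Hp Hpmax _] [Hp' _ Hp'last].
have Hsz : size w' = size w by rewrite Ew Ew' !size_cat.
have Hm : size s < size w by rewrite Ew size_cat /=; lia.
have Hwm : nth 0 w (size s) = i by rewrite Ew nth_cat ltnn subnn.
have Hwm' : nth 0 w' (size s) = i.+1 by rewrite Ew' nth_cat ltnn subnn.
have Hww q : q != size s -> nth 0 w' q = nth 0 w q.
  move=> Hq; rewrite Ew Ew' !nth_cat; case: ltnP => // Hq'.
  by case E: (q - size s) => [|k] //; lia.
rewrite leqNgt; apply/negP => Hlt.
have H1 : nth 0 w' p < nth 0 w' p' by apply: Hp'last; lia.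
have H2 : nth 0 w p' <= nth 0 w p by apply: Hpmax; lia.
have H3 : nth 0 w (size s) <= nth 0 w p by apply: Hpmax.
have [Ep|Np] := eqVneq p (size s).
  by rewrite Ep Hwm' Hww in H1; [rewrite Ep Hwm in H2|]; lia.
rewrite Hww // in H1.
have [Ep'|Np'] := eqVneq p' (size s); last by rewrite Hww // in H1; lia.
rewrite Ep' Hwm' in H1.
have Hwp : nth 0 w p = i by lia.
have Hit : i \in t.
  have -> : i = nth 0 t (p - size s).-1.
    rewrite -Hwp Ew nth_cat ifF; last by lia.
    by case E: (p - size s) => [|k] //; lia.
  by apply: mem_nth; move: Hp; rewrite Ew size_cat /=; lia.
have := Ht (size t); rewrite take_size leqNgt => /negP; apply.
rewrite (_ : count_mem i.+1 t = 0) -?has_count ?has_pred1 //.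
apply/count_memPn/negP => Ht'.
have /(nthP 0) [q Hq Eq] : i.+1 \in w by rewrite Ew mem_cat inE Ht' !orbT.
by have := Hpmax q Hq; rewrite Eq Hwp ltnn.
Qed.

Lemma CS_edge_index la n T T' : CS_edge la n T T' ->
  index (sumn la) (row_word T) <= index (sumn la) (row_word T').
Proof.
case=> _ [b [b' [i [/andP [/andP [/eqP Hb _] _] _ _ /f_tabP [Hsh Hf] [<- <-]]]]].
rewrite !row_word_std -Hb -size_row_word.
have Hsz := f_rel_size _ _ _ Hf.
case: (posnP (size (row_word b))) => [H0|Hpos].
  by move: H0 (H0); rewrite -[X in X = _ -> _]Hsz => /size0nil -> /size0nil ->.
apply: (f_rel_last_max _ _ _ _ _ Hf); first exact: last_max_index.
by rewrite -Hsz; apply: last_max_index; rewrite Hsz.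
Qed.

Lemma CS_path_index la n T T' :
  clos_refl_trans _ (CS_edge la n) T T' ->
  index (sumn la) (row_word T) <= index (sumn la) (row_word T').
Proof.
elim=> [? ? /CS_edge_index//|//|? ? ? _ H1 _ H2]; exact: leq_trans H1 H2.
Qed.

(** * Tableaux with the largest entry in a chosen corner *)

(** The row superstandard filling; the free starting value [k] lets it split along a concatenation
    of shapes. *)
Definition superstandard (la : seq nat) (k : nat) : seq (seq nat) :=
  reshape la (iota k (sumn la)).

Lemma superstandard_cons x la k :
  superstandard (x :: la) k = iota k x :: superstandard la (k + x).
Proof.
rewrite /superstandard /= iotaD take_size_cat ?size_iota //.
by rewrite drop_size_cat ?size_iota.
Qed.

Lemma superstandard_cat la mu k :
  superstandard (la ++ mu) k =
  superstandard la k ++ superstandard mu (k + sumn la).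
Proof.
elim: la k => [|x la IH] k; first by rewrite addn0.
by rewrite cat_cons !superstandard_cons IH [sumn (_ :: _)]/= addnA.
Qed.

Lemma superstandard_rcons la z k :
  superstandard (rcons la z) k = rcons (superstandard la k) (iota (k + sumn la) z).
Proof. by rewrite -!cats1 superstandard_cat superstandard_cons. Qed.

Lemma row_word_rcons t r : row_word (rcons t r) = r ++ row_word t.
Proof. by rewrite /row_word rev_rcons. Qed.

Lemma shape_superstandard la k : shape (superstandard la k) = la.
Proof. by rewrite -[shape]/(@seq.shape nat) reshapeKl ?size_iota. Qed.

Lemma flatten_superstandard la k :
  flatten (superstandard la k) = iota k (sumn la).
Proof. by rewrite reshapeKr ?size_iota. Qed.

Lemma ss_cond_superstandard la k : sorted geq la -> ss_cond (superstandard la k).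
Proof.
move=> Hla; rewrite ss_condE; apply/andP; split.
  elim: la k {Hla} => [|x la IH] k //.
  by rewrite superstandard_cons [all _ _]/= iota_sorted IH.
elim: la k Hla => [|x la IH] k // Hla.
have {IH} := IH (k + x) (path_sorted Hla); rewrite superstandard_cons.
case: la Hla => [|y la] //; rewrite superstandard_cons /= => /andP [Hyx _] ->.
rewrite andbT; apply/belowP => j; rewrite size_iota => Hj.
by rewrite !nth_iota; lia.
Qed.

Lemma superstandard_SYT la : sorted geq la -> is_SYT la (superstandard la 1).
Proof.
move=> Hla; rewrite /is_SYT shape_superstandard eqxx flatten_superstandard.
by rewrite ss_cond_superstandard /=.
Qed.

(** As [N.+1] exceeds all other entries, only the row above [R] could be disturbed, and since [mu]
    is sorted that row does not reach the new cell. *)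
Lemma add_corner_SYT A R B N la mu :
  is_SYT mu (A ++ R :: B) -> N = sumn mu ->
  la = shape (A ++ rcons R N.+1 :: B) -> sorted geq mu ->
  is_SYT la (A ++ rcons R N.+1 :: B).
Proof.
move=> /andP [/andP [/eqP Hsh Hss] Hperm] HN Hla Hsorted.
rewrite /is_SYT -Hla eqxx /=; apply/andP; split; last first.
  have -> : sumn la = N + 1.
    rewrite HN -Hsh Hla /shape !map_cat /= !sumn_cat /= size_rcons; lia.
  apply/permP => a; have /permP/(_ a) := Hperm.
  rewrite iotaD add1n -HN !flatten_cat /= -cats1 !count_cat /=; lia.
have Hall x : x \in flatten (A ++ R :: B) -> x <= N.
  by rewrite (perm_mem Hperm) mem_iota HN; lia.
move: Hss; rewrite !ss_condE => /andP [Hrows Hcols]; apply/andP; split.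
  move: Hrows; rewrite !all_cat /= => /and3P [-> HR ->]; rewrite andbT /=.
  have HRN : all (leq^~ N.+1) R.
    apply/allP => x Hx; apply/leqW/Hall.
    by rewrite flatten_cat mem_cat /= mem_cat Hx orbT.
  case: R HR HRN {Hsh Hperm Hall Hcols Hla} => [|y R] //=.
  rewrite rcons_path => -> /andP [Hy HRN].
  by have := mem_last y R; rewrite inE => /predU1P [->|/(allP HRN)].
move: Hcols; rewrite !sorted_cat_cons => /andP [H1 H2]; apply/andP; split.
  case/lastP: A H1 {Hsh Hperm Hrows Hla H2} Hall => // A a H1 Hall.
  move: H1; rewrite -![rcons (rcons A a) _]cats1 !cat_rcons !sorted_cat_cons.
  case/andP=> -> /=; rewrite !andbT => /belowP H1; apply/belowP => j.
  rewrite size_rcons => Hj; rewrite -cats1 nth_cat.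
  case: (ltnP j (size R)) => HjR; first exact: H1.
  have -> : j - size R = 0 by lia.
  (* If the row below has no cell in this column, the default entry 0 takes its place and is still
     small enough. *)
  rewrite /= ltnS; case: (ltnP j (size a)) => Ha; last by rewrite nth_default.
  apply: Hall; rewrite cat_rcons flatten_cat mem_cat /= mem_cat.
  by rewrite mem_nth ?orbT.
case: B H2 Hsh {Hla Hperm Hrows Hall H1} => //= b B /andP [/belowP Hb ->] Hsh.
rewrite andbT; apply/belowP => j Hj; rewrite nth_rcons ifT; first exact: Hb.
apply: leq_trans Hj _; move: Hsorted.
by rewrite -Hsh /shape map_cat sorted_cat_cons => /and3P [].
Qed.

(** The drop will supply a removable cell outside the top row. *)
Lemma constant_or_drop la : sorted geq la ->
  (exists w l, la = nseq l w) \/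
  exists A x y B, la = A ++ x :: y :: B /\ y < x.
Proof.
elim: la => [|x la IH] Hla; first by left; exists 0, 0.
move: Hla (IH (path_sorted Hla)) => /[swap].
case=> [[w [[|l] ->]]|[A [y [z [B [-> H]]]]]] Hla.
- by left; exists x, 1.
- have [<-|Nx] := eqVneq x w; first by left; exists x, l.+2.
  right; exists [::], x, w, (nseq l w); split=> //.
  by case/andP: Hla => Hwx _; rewrite ltn_neqAle eq_sym Nx; apply: Hwx.
- by right; exists (x :: A), y, z, B.
Qed.

Lemma sorted_rcons_sub (T : Type) (e : rel T) s x y :
  (forall a, e a x -> e a y) -> sorted e (rcons s x) -> sorted e (rcons s y).
Proof.
move=> Hxy; case: s => [|a s] //=; rewrite !rcons_path.
by move=> /andP [-> /Hxy ->].
Qed.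

Lemma strongly_connected_rectangle la n :
  is_partition la -> CS_strongly_connected la n ->
  exists w l, la = nseq l w.
Proof.
move=> /andP [Hla Hpos] Hconn.
case: (constant_or_drop la Hla) => // -[A [x [y [B [Ela Hyx]]]]]; exfalso.
(* [z] is the length of the top row. *)
have [C [z Ez]] : exists C z, y :: B = rcons C z.
  by case/lastP: B {Ela} => [|B z]; [exists [::], y|exists (y :: B), z].
have Hz : 0 < z.
  by move: Hpos; rewrite Ela Ez all_cat /= all_rcons => /and4P [].
(* Removing the last cell of the row of length [x] keeps the row lengths decreasing, because
   [y < x]. *)
have Hmu : sorted geq (A ++ x.-1 :: rcons C z).
  move: Hla; rewrite Ela -Ez !sorted_cat_cons => /and3P [HA _ HB].
  apply/and3P; split=> //; last by rewrite /geq /=; lia.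
  by apply: sorted_rcons_sub HA => a; apply: leq_trans (leq_pred x).
set mu := (A ++ _ :: _) in Hmu.
have Hsum : sumn la = (sumn mu).+1.
  by rewrite Ela Ez !sumn_cat /=; lia.
(* The removed corner is refilled with the largest entry. *)
pose T := superstandard A 1 ++
  rcons (iota (1 + sumn A) x.-1) (sumn mu).+1 ::
  superstandard (rcons C z) (1 + sumn A + x.-1).
have HT : is_SYT la T.
  apply: (@add_corner_SYT _ _ _ _ _ mu) => //.
    rewrite -superstandard_cons -superstandard_cat; exact: superstandard_SYT.
  rewrite /shape map_cat map_cons size_rcons size_iota prednK; last by lia.
  rewrite -[map size (superstandard A 1)]/(shape _).
  rewrite -[map size (superstandard (rcons C z) _)]/(shape _).
  by rewrite !shape_superstandard Ela Ez.
have := CS_path_index _ _ _ _ (Hconn _ _ HT (superstandard_SYT _ Hla)).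
apply/negP; rewrite -ltnNge.
rewrite /T superstandard_rcons -rcons_cons -rcons_cat Hsum.
have {1}-> : la = rcons (A ++ x :: C) z by rewrite Ela Ez rcons_cat.
(* Both reading words begin with the [z] letters of the top row. The superstandard tableau has its
   largest entry there, while [T] has it in a lower row. *)
rewrite superstandard_rcons !row_word_rcons !index_cat !mem_iota ifT ?ifF.
- rewrite size_iota ltn_addr //.
  rewrite -[X in _ < X](size_iota (1 + sumn (A ++ x :: C))).
  by rewrite index_mem mem_iota /mu -cats1 !sumn_cat /= sumn_cat /=; lia.
- by rewrite /mu -cats1 !sumn_cat /= sumn_cat /=; lia.
- by rewrite /mu -cats1 !sumn_cat /= sumn_cat /=; lia.
Qed.

(** * Rectangles *)

Lemma flatten_split (T : eqType) (L : seq (seq T)) s x t :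
  flatten L = s ++ x :: t ->
  exists L1 X Y L2, [/\ L = L1 ++ (X ++ x :: Y) :: L2,
                        s = flatten L1 ++ X & t = Y ++ flatten L2].
Proof.
elim: L s => [|r L IH] s /=; first by case: s.
case: (leqP (size r) (size s)) => Hrs E.
  have [s' Es] : exists s', s = r ++ s'.
    exists (drop (size r) s); rewrite -[LHS](cat_take_drop (size r)).
    by have /(congr1 (take (size r))) := E; rewrite take_size_cat // takel_cat // => <-.
  move/eqP: E; rewrite Es -catA eqseq_cat // eqxx => /eqP /IH.
  move=> [L1 [X [Y [L2 [-> -> ->]]]]].
  by exists (r :: L1), X, Y, L2; rewrite /= catA.
exists [::], s, (drop (size s).+1 r), L; split=> //=.
  congr (_ :: _); rewrite -[LHS](cat_take_drop (size s)) (drop_nth x) //.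
  have := congr1 (take (size s)) E; rewrite take_cat Hrs take_size_cat // => ->.
  have := congr1 (nth x ^~ (size s)) E.
  by rewrite !nth_cat Hrs ltnn subnn /= => ->.
have /(congr1 (drop (size s).+1)) := E; rewrite drop_cat.
have -> : s ++ x :: t = rcons s x ++ t by rewrite cat_rcons.
rewrite [X in _ = X]drop_size_cat ?size_rcons // => <-.
case: ltnP => // Hge; rewrite [drop _ r]drop_oversize //.
by rewrite (_ : _ - size r = 0) ?drop0; last by lia.
Qed.

(* An [i.+1] right above the changed [i] would, together with its neighbours to the
   left, start a suffix of the reading word with more letters [i.+1] than [i]. *)
Lemma below_bracket i s r X Y :
  sorted leq r -> sorted leq (X ++ i :: Y) -> below (X ++ i :: Y) r ->
  suffix_closed i (s ++ r ++ X) -> below (X ++ i.+1 :: Y) r.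
Proof.
move=> Hr HX /belowP Hb Hs; apply/belowP => j Hj.
have := Hb j Hj; rewrite !nth_cat; case: (ltnP j (size X)) => // HjX.
case Ej: (j - size X) => [|k] //= Hij.
rewrite ltn_neqAle Hij andbT; apply/negP => /eqP Ei.
have {}Ej : j = size X by lia.
(* The column where the letters [i] preceding the changed cell begin, or that cell's own column if
   there are none. From [d] up to that cell the row above is filled with [i.+1]. *)
pose d := index i X; have Hd : d <= size X := index_size _ _.
have HXd k : d <= k < size X -> i <= nth 0 X k.
  move=> /andP [Hdk HkX]; have Hi : i \in X by rewrite -index_mem (leq_ltn_trans Hdk).
  rewrite -[X in X <= _](nth_index 0 Hi).
  move: HX => /cat_sorted2 [HX _].
  by apply: (sorted_leq_nth leq_trans leqnn 0 HX) => //; rewrite inE; lia.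
have Hrmono k l : k <= l < size r -> nth 0 r k <= nth 0 r l.
  move=> Hkl; apply: (sorted_leq_nth leq_trans leqnn 0 Hr); rewrite ?inE; lia.
have Hgt k : d <= k < size r -> i < nth 0 r k.
  move=> Hk; case: (ltnP k (size X)) => HkX.
    have := Hb k; rewrite nth_cat HkX; have := HXd k; lia.
  by rewrite Ei; apply: Hrmono; lia.
have := Hs (d + size s); rewrite -drop_drop drop_size_cat // drop_cat ifT; last by lia.
rewrite !count_cat.
have -> : count_mem i (drop d r) = 0.
  apply/count_memPn/negP => /(nthP 0) [k]; rewrite size_drop nth_drop => Hk Ek.
  have : i < nth 0 r (d + k) by apply: Hgt; move: Hk => /=; lia.
  by rewrite Ek ltnn.
have HX1 : count_mem i X <= size X - d.
  rewrite -[X in count_mem i X](cat_take_drop d) count_cat -size_drop.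
  rewrite (count_memPn _) ?count_size //.
  by apply/negP => /index_ltn; rewrite ltnn.
have Hr1 : (size X - d).+1 <= count_mem i.+1 (drop d r).
  rewrite -(cat_take_drop (size X - d).+1 (drop d r)) count_cat.
  apply: leq_trans (leq_addr _ _).
  have Hsz : size (take (size X - d).+1 (drop d r)) = (size X - d).+1.
    by rewrite size_takel // size_drop; lia.
  rewrite -[X in X <= _]Hsz -[X in X <= _]count_predT.
  apply: eq_leq; apply: eq_in_count => y /(nthP 0) [k Hk <-].
  rewrite /= in Hk; rewrite Hsz in Hk; rewrite nth_take // nth_drop.
  have H1 : i < nth 0 r (d + k) by apply: Hgt; lia.
  have H2 : nth 0 r (d + k) <= nth 0 r j by apply: Hrmono; lia.
  by rewrite /=; lia.
lia.
Qed.

(** Only the right neighbour and the cell above can obstruct raising the entry: the bracketing in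
    [t] excludes the former, [below_bracket] the latter. *)
Lemma f_rel_SSYT la n i b w' :
  is_SSYT la n b -> i < n -> f_rel i (row_word b) w' ->
  exists2 b', is_SSYT la n b' & row_word b' = w' /\ f_tab i b = Some b'.
Proof.
move=> /andP [/andP [/eqP Hsh Hss] Hrange] Hin Hf; have [s [t [Hw -> Hs Ht]]] := Hf.
have [L1 [X [Y [L2 [HL Es Et]]]]] := flatten_split _ _ _ _ _ Hw.
have Eb : b = rev L2 ++ (X ++ i :: Y) :: rev L1.
  by rewrite -[b]revK HL rev_cat rev_cons cat_rcons.
pose b' := rev L2 ++ (X ++ i.+1 :: Y) :: rev L1.
have Hsh' : shape b' = shape b by rewrite Eb /shape !map_cat /= !size_cat.
have Hrow : row_word b' = s ++ i.+1 :: t.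
  rewrite /row_word rev_cat rev_cons !revK cat_rcons flatten_cat /= Es Et.
  by rewrite -!catA.
exists b'; last first.
  by split=> //; apply/f_tabP; rewrite Hrow; split=> //; exists s, t.
rewrite /is_SSYT Hsh' Hsh eqxx /=; apply/andP; split; last first.
  move: Hrange; rewrite Eb /b' !flatten_cat /= !all_cat /=.
  by move=> /and3P [-> /and3P [-> _ ->] ->]; rewrite Hin.
move: Hss; rewrite !ss_condE Eb !all_cat !sorted_cat_cons /=.
move=> /andP [/and3P [-> HR Hup] /andP [Hlo Hcol]] /=.
rewrite Hup andbT; apply/and3P; split.
- move: HR; rewrite !sorted_cat_cons => /andP [HX HY]; apply/andP; split.
    by apply: sorted_rcons_sub HX => a; apply: leqW.
  case: Y HY {Hw HL Eb b' Hsh' Hrow Hlo Hcol} Et => [|y Y] //=.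
  move=> /andP [Hy ->] Et; rewrite andbT.
  (* A right neighbour [i] would be the first letter of [t], where nothing in [t] can bracket it. *)
  rewrite ltn_neqAle Hy andbT; apply/eqP => Eiy.
  by have := Ht 1; rewrite Et -Eiy /= take0 /= eqxx; case: eqP; lia.
- apply: sorted_rcons_sub Hlo => a /belowP Ha; apply/belowP => j.
  rewrite size_cat /= -[size X + _](size_cat X (i :: Y)) => /Ha Hj; apply: leq_trans Hj _.
  by rewrite !nth_cat; case: ifP => // _; case: (_ - _) => [|k] /=.
- case: (lastP L1) Hs Hup Hcol Es => [|L1' r] //; rewrite rev_rcons => Hs.
  case/andP=> Hr _ /= /andP [Hb ->] Es; rewrite andbT.
  apply: (below_bracket i (flatten L1')) => //.
  by rewrite catA -flatten_rcons -Es.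
Qed.

(** * The lowest weight element of a rectangle *)

(** [P] is the part of the reading word before the rows [L], which are listed from the top. If the
    first row began with some [y < m], this [y] would be unbracketed, as no [y.+1] occurs in [P]. So
    the row is constant [m], and column strictness bounds the next row by [m.-1]. *)
Lemma prefix_closed_rows n m w P L :
  (forall i, 0 < i < n -> prefix_closed i (P ++ flatten L)) ->
  all (fun r => size r == w) L -> all (sorted leq) L ->
  sorted (fun r r' => below r' r) L -> all (leq 1) (flatten L) ->
  m <= n -> all (leq m.+1) P -> all (geq m) (head [::] L) ->
  L = mkseq (fun j => nseq w (m - j)) (size L).
Proof.
elim: L m P => [|r L IH] m P //= Hpc /andP [/eqP Hr Hsz] /andP [Hrs Hss] Hcol.
rewrite all_cat => /andP [Hr1 Hpos] Hmn HP Hrm.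
have Er : r = nseq w m.
  rewrite -Hr; apply/all_pred1P.
  case: r Hr Hrs Hcol Hr1 Hrm Hpc => [|y r] //= _ Hrs _ /andP [Hy _].
  move=> /andP [Hym Hrm] Hpc.
  have {Hym} Ey : y = m.
    apply/eqP; rewrite eqn_leq [y <= m]Hym leqNgt; apply/negP => Hlt.
    have Hyn : 0 < y < n by lia.
    have := Hpc y Hyn (size P).+1; rewrite take_cat ifF; last by lia.
    rewrite subSnn /= take0 !count_cat /= eqxx.
    rewrite (_ : count_mem y.+1 P = 0); first by case: eqP; lia.
    by apply/count_memPn/negP => /(allP HP); lia.
  rewrite Ey eqxx /=; apply/allP => z Hz.
  have := allP Hrm z Hz; have := order_path_min leq_trans Hrs => /allP /(_ z Hz).
  by rewrite Ey /= /geq /=; lia.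
rewrite /mkseq /= subn0 -Er; congr (_ :: _).
rewrite [LHS](IH m.-1 (P ++ r)) //.
- rewrite (iotaDl 1 0) -map_comp; apply: eq_map => j /=.
  by rewrite -subn1 -subnDA.
- by move=> i Hi; rewrite -catA; apply: Hpc.
- exact: path_sorted Hcol.
- by lia.
- rewrite all_cat; apply/andP; split.
    by apply: sub_all HP => z; lia.
  apply/allP => z Hz; have := allP Hr1 z Hz.
  by move: Hz; rewrite Er mem_nseq => /andP [_ /eqP ->] /=; lia.
- case: L Hsz Hcol {IH Hpc Hss Hpos} => [|r' L] //=.
  move=> /andP [/eqP Hr' _] /andP [/belowP Hb _].
  apply/(all_nthP 0) => j Hj; have := Hb j; rewrite Hr -Hr' => /(_ Hj).
  by rewrite Er nth_nseq -Hr' Hj /geq /=; lia.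
Qed.

(** For [c] equal to 0 this is the highest weight element, for [c] equal to [n - l] the lowest. *)
Definition constant_rows (w l c : nat) : seq (seq nat) :=
  mkseq (fun j => nseq w (c + j).+1) l.

(** The bracketing hypothesis says that no [f_i] applies, which forces the rows one after another
    from the top. *)
Lemma lowest_weight l w n b :
  l <= n -> is_SSYT (nseq l w) n b ->
  (forall i, 0 < i < n -> prefix_closed i (row_word b)) ->
  b = constant_rows w l (n - l).
Proof.
move=> Hln /andP [/andP [/eqP Hsh]]; rewrite ss_condE => /andP [Hrows Hcols].
move=> Hrange Hpc.
have Hl : size b = l by rewrite -(size_map size) [map _ _]Hsh size_nseq.
have : rev b = mkseq (fun j => nseq w (n - j)) (size (rev b)).
  apply: (prefix_closed_rows n n w [::]) => //.
  - by rewrite all_rev -(all_map size (pred1 w)) [map _ _]Hsh all_pred1_nseq.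
  - by rewrite all_rev.
  - by rewrite rev_sorted.
  - apply/allP => x /flattenP [r]; rewrite mem_rev => Hr Hx.
    by have /(allP Hrange)/andP [] : x \in flatten b by apply/flattenP; exists r.
  - case/lastP: b Hrange {Hl Hpc Hsh Hrows Hcols} => [|b r] //.
    rewrite rev_rcons flatten_rcons all_cat => /andP [_] /=.
    by apply: sub_all => x /andP [].
move/(congr1 rev); rewrite revK size_rev Hl => ->.
apply: (@eq_from_nth _ [::]); rewrite size_rev !size_mkseq // => j Hj.
rewrite nth_rev size_mkseq // !nth_mkseq //; last by lia.
by congr nseq; lia.
Qed.

Definition compl (n x : nat) : nat := n.+1 - x.

Definition dual_word (n : nat) (w : seq nat) : seq nat := rev (map (compl n) w).

(* Rotation by a half turn composed with [x |-> n.+1 - x]; it stays within the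
   semistandard tableaux because the shape is a rectangle. *)
Definition dual (n : nat) (t : seq (seq nat)) : seq (seq nat) :=
  rev (map (dual_word n) t).

Lemma row_word_dual n t : row_word (dual n t) = dual_word n (row_word t).
Proof.
rewrite /row_word /dual revK; elim: t => [|r t IH] //=.
by rewrite rev_cons flatten_rcons /dual_word map_cat rev_cat -/(dual_word n _) IH.
Qed.

Lemma dualK l w n t : is_SSYT (nseq l w) n t -> dual n (dual n t) = t.
Proof.
move=> /andP [_ /allP Hrange]; rewrite /dual map_rev revK -map_comp.
rewrite -[RHS]map_id; apply/eq_in_map => r Hr.
rewrite /= /dual_word map_rev revK -map_comp -[RHS]map_id.
apply/eq_in_map => x Hx; have /Hrange : x \in flatten t by apply/flattenP; exists r.
by rewrite /= /compl; lia.
Qed.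

Lemma dual_SSYT l w n t : is_SSYT (nseq l w) n t -> is_SSYT (nseq l w) n (dual n t).
Proof.
move=> /andP [/andP [/eqP Hsh]]; rewrite ss_condE => /andP [Hrows Hcols] Hrange.
have Hsz (r : seq nat) : r \in t -> size r = w.
  by move=> /(map_f size); rewrite [map _ _]Hsh mem_nseq => /andP [_ /eqP].
have Hn (r : seq nat) (x : nat) : r \in t -> x \in r -> 0 < x <= n.
  by move=> Hr Hx; apply: (allP Hrange); apply/flattenP; exists r.
apply/andP; split; first (apply/andP; split).
- rewrite /shape /dual map_rev -map_comp (eq_map (g := size)).
    rewrite [map _ _]Hsh; apply/eqP/(@eq_from_nth _ 0); rewrite ?size_rev // => i.
    rewrite size_nseq => Hi.
    by rewrite nth_rev size_nseq // !nth_nseq Hi ifT //; lia.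
  by move=> r /=; rewrite size_rev size_map.
- rewrite ss_condE; apply/andP; split.
    rewrite /dual all_rev all_map; apply: sub_all Hrows => r /= Hr.
    rewrite rev_sorted sorted_map; apply: sub_sorted Hr => x y /=.
    by rewrite /compl; lia.
  rewrite /dual rev_sorted sorted_map.
  apply: (@sub_in_sorted _ (mem t) below); [|exact/allP|exact: Hcols].
  move=> r r' Hr Hr' /belowP Hb; apply/belowP => j.
  have Hrw : size r = w := Hsz r Hr; have Hrw' : size r' = w := Hsz r' Hr'.
  rewrite size_rev size_map Hrw => Hj.
  (* All rows have length [w], so the half turn sends column [j] to column [w - j.+1] in every row
     and the columns stay aligned. *)
  have Hk : w - j.+1 < w by lia.
  rewrite !nth_rev !size_map ?Hrw ?Hrw' // !(nth_map 0) ?Hrw ?Hrw' //.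
  have H1 : nth 0 r (w - j.+1) < nth 0 r' (w - j.+1) by apply: Hb; rewrite Hrw'.
  have H2 : 0 < nth 0 r' (w - j.+1) <= n by apply: (Hn r'); rewrite // mem_nth // Hrw'.
  by rewrite /compl; lia.
- apply/allP => x /flattenP [r]; rewrite mem_rev => /mapP [r' Hr' ->].
  by rewrite mem_rev => /mapP [y /(Hn _ _ Hr') Hy ->]; rewrite /compl; lia.
Qed.

Lemma count_dual_word n i w :
  all (fun x => 0 < x <= n) w -> 0 < i <= n ->
  count_mem (compl n i) (map (compl n) w) = count_mem i w.
Proof.
move=> /allP Hw Hi; rewrite count_map; apply: eq_in_count => x /Hw /=.
by rewrite /compl; lia.
Qed.

(** Complementing turns [i] and [i.+1] into [(n - i).+1] and [n - i], and reversal exchanges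
    prefixes with suffixes. The two bracketing conditions trade places and the arrow is reversed. *)
Lemma f_rel_dual n i w w' :
  all (fun x => 0 < x <= n) w -> 0 < i < n -> f_rel i w w' ->
  f_rel (n - i) (dual_word n w') (dual_word n w).
Proof.
move=> Hw Hi [s [t [Ew -> Hs Ht]]].
have Ei : compl n i = (n - i).+1 by rewrite /compl; lia.
have Ei1 : compl n i.+1 = n - i by rewrite /compl; lia.
move: Hw; rewrite Ew all_cat /= => /and3P [Hws _ Hwt].
exists (dual_word n t), (dual_word n s); split.
- by rewrite /dual_word map_cat rev_cat /= rev_cons Ei1 cat_rcons.
- by rewrite /dual_word map_cat rev_cat /= rev_cons Ei cat_rcons.
- move=> j; rewrite drop_rev !count_rev -map_take -Ei -Ei1.
  have Hall k : all (fun x => 0 < x <= n) (take k t).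
    by apply/allP => x /mem_take /(allP Hwt).
  by rewrite !count_dual_word //; lia.
- move=> j; rewrite take_rev !count_rev -map_drop -Ei -Ei1.
  have Hall k : all (fun x => 0 < x <= n) (drop k s).
    by apply/allP => x /mem_drop /(allP Hws).
  by rewrite !count_dual_word //; lia.
Qed.

Lemma dual_constant_rows w l n :
  l <= n -> dual n (constant_rows w l (n - l)) = constant_rows w l 0.
Proof.
move=> Hln; apply: (@eq_from_nth _ [::]).
  by rewrite size_rev size_map !size_mkseq.
move=> j; rewrite size_rev size_map size_mkseq => Hj.
rewrite nth_rev size_map size_mkseq // (nth_map [::]) ?size_mkseq; last by lia.
rewrite !nth_mkseq //; last by lia.
rewrite /dual_word map_nseq; apply: (@eq_from_nth _ 0).
  by rewrite size_rev !size_nseq.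
rewrite size_rev size_nseq => k Hk.
by rewrite nth_rev size_nseq // !nth_nseq Hk ifT /compl; lia.
Qed.

(** * Standardization and closed walks *)

Lemma std_word_shift c w : std_word (map (addn c) w) = std_word w.
Proof.
rewrite /std_word size_map; apply/eq_in_map => p; rewrite mem_iota => /= Hp.
rewrite (nth_map 0) // -map_take !count_map; congr (_ + _).+1.
  by apply: eq_count => x /=; lia.
by apply: eq_count => x /=; lia.
Qed.

Lemma std_constant_rows w l c c' :
  std (constant_rows w l c) = std (constant_rows w l c').
Proof.
suff H d : std (constant_rows w l d) = std (constant_rows w l 0) by rewrite !H.
have Hmap : constant_rows w l d = map (map (addn d)) (constant_rows w l 0).
  rewrite /constant_rows /mkseq -map_comp; apply: eq_map => j /=.
  by rewrite map_nseq addnS.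
rewrite /std; congr of_word.
  by rewrite /shape Hmap -map_comp; apply: eq_map => r /=; rewrite size_map.
by rewrite Hmap /row_word -map_rev -map_flatten std_word_shift.
Qed.

(** Edges of the skeleton join distinct tableaux, so a step that keeps the standardization
    contributes the empty path. *)
Lemma f_tab_std_path la n i b b' :
  is_SSYT la n b -> is_SSYT la n b' -> 0 < i < n -> f_tab i b = Some b' ->
  clos_refl_trans _ (CS_edge la n) (std b) (std b').
Proof.
move=> Hb Hb' Hi Hf; have [->|/eqP Hne] := eqVneq (std b) (std b').
  exact: rt_refl.
by apply: rt_step; split=> //; exists b, b', i.
Qed.

Lemma sumn_le_size n w : all (leq^~ n) w -> sumn w <= n * size w.
Proof. by elim: w => [|x w IH] //= /andP [Hx /IH]; lia. Qed.

Lemma f_rel_sumn i w w' : f_rel i w w' -> sumn w' = (sumn w).+1.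
Proof. by case=> s [t [-> -> _ _]]; rewrite !sumn_cat /=; lia. Qed.

Lemma row_word_range la n b :
  is_SSYT la n b -> all (fun x => 0 < x <= n) (row_word b).
Proof.
move=> /andP [_ /allP Hb]; apply/allP => x /flattenP [r]; rewrite mem_rev => Hr Hx.
by apply: Hb; apply/flattenP; exists r.
Qed.

(** Both paths come from one induction: a step from [b] to [b'] extends the first path at its start,
    and the dual step from [dual n b'] to [dual n b] extends the second at its end. *)
Lemma to_from_constant_rows l w n b :
  l <= n -> is_SSYT (nseq l w) n b ->
  clos_refl_trans _ (CS_edge (nseq l w) n) (std b)
    (std (constant_rows w l (n - l))) /\
  clos_refl_trans _ (CS_edge (nseq l w) n) (std (constant_rows w l 0))
    (std (dual n b)).
Proof.
(* Entries are at most [n] and each step raises their sum by one, which bounds the number of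
   steps. *)
move=> Hln; have [k] := ubnP (n * (w * l) - sumn (row_word b)).
elim: k b => // k IH b Hk Hb.
have Hrange := row_word_range _ _ _ Hb.
have [/hasP [i]|/hasPn Hnone] :=
  boolP (has (fun i => f_word i (row_word b)) (iota 1 n.-1)).
  rewrite mem_iota; case Ef: f_word => [w'|] // Hi _.
  have {}Hi : 0 < i < n by lia.
  move/f_wordP: Ef => Hf.
  have [b' Hb' [Erow Hfb]] := f_rel_SSYT _ _ _ _ _ Hb (proj2 (andP Hi)) Hf.
  have [|IH1 IH2] := IH b' _ Hb'.
    have : sumn (row_word b') <= n * size (row_word b').
      by apply/sumn_le_size/(sub_all _ (row_word_range _ _ _ Hb')) => x /andP [].
    rewrite size_row_word; have /andP [/andP [/eqP -> _] _] := Hb'.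
    by rewrite sumn_nseq Erow (f_rel_sumn _ _ _ Hf); lia.
  split; first by apply: rt_trans IH1; apply: f_tab_std_path Hfb.
  apply: rt_trans IH2 _.
  apply: (f_tab_std_path _ _ (n - i)); [exact: dual_SSYT..|by lia|].
  apply/f_tabP; rewrite !row_word_dual Erow; split; last exact: f_rel_dual.
  have /andP [/andP [/eqP -> _] _] := dual_SSYT _ _ _ _ Hb.
  by have /andP [/andP [/eqP -> _] _] := dual_SSYT _ _ _ _ Hb'.
rewrite (lowest_weight l w n b) //.
  by rewrite dual_constant_rows //; split; apply: rt_refl.
move=> i Hi; case: (f_rel_or_prefix_closed i (row_word b)) => // -[w' Hf].
have /Hnone : i \in iota 1 n.-1 by rewrite mem_iota; lia.
by rewrite (f_rel_word _ _ _ Hf).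
Qed.

Lemma SYT_SSYT la n T : sumn la <= n -> is_SYT la T -> is_SSYT la n T.
Proof.
move=> Hn /andP [Hss Hperm]; apply/andP; split=> //.
by apply/allP => x; rewrite (perm_mem Hperm) mem_iota; lia.
Qed.

(** A permutation of 1, ..., N has exactly [x.-1] letters below its letter [x] and no second [x], so
    relabelling returns [x]. *)
Lemma std_SYT la T : is_SYT la T -> std T = T.
Proof.
move=> /andP [_ Hperm].
have {Hperm} : perm_eq (row_word T) (iota 1 (sumn la)).
  apply: perm_trans Hperm; apply/permP => a.
  by rewrite /row_word !count_flatten map_rev sumn_rev.
move=> Hperm; rewrite /std -[RHS]of_word_row_word; congr of_word.
move: (row_word T) Hperm => w Hperm; apply: (@eq_from_nth _ 0).
  by rewrite size_std_word.
rewrite size_std_word => p Hp; rewrite (nth_map 0) ?size_iota // nth_iota // add0n.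
have Huniq : uniq w by rewrite (perm_uniq Hperm) iota_uniq.
have Hx : 0 < nth 0 w p < (sumn la).+1.
  by have := mem_nth 0 Hp; rewrite (perm_mem Hperm) mem_iota.
rewrite (permP Hperm) (count_memPn _) ?addn0; last first.
  by apply/negP => /index_ltn; rewrite index_uniq // ltnn.
rewrite (_ : sumn la = (nth 0 w p).-1 + (sumn la - (nth 0 w p).-1)); last by lia.
rewrite iotaD count_cat (eq_in_count (a2 := predT)) ?count_predT ?size_iota.
  rewrite (eq_in_count (a2 := pred0)) ?count_pred0; first by lia.
  by move=> x; rewrite mem_iota /=; lia.
by move=> x; rewrite mem_iota /=; lia.
Qed.

Lemma rectangle_strongly_connected l w n :
  l <= n -> w * l <= n -> CS_strongly_connected (nseq l w) n.
Proof.
move=> Hl Hwl T T' HT HT'.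
have HS U : is_SYT (nseq l w) U -> is_SSYT (nseq l w) n U.
  by apply: SYT_SSYT; rewrite sumn_nseq.
have [Hlow _] := to_from_constant_rows _ _ _ _ Hl (HS _ HT).
(* Taken for the dual of [T'], the second path ends at [T'], because [dual] is an involution. It
   starts where the first path ends, as the two extreme elements have the same standardization. *)
have [_] := to_from_constant_rows _ _ _ _ Hl (dual_SSYT _ _ _ _ (HS _ HT')).
rewrite (dualK _ _ _ _ (HS _ HT')) (std_SYT _ _ HT') => Hhigh.
rewrite (std_SYT _ _ HT) (std_constant_rows _ _ _ 0) in Hlow.
exact: rt_trans Hlow Hhigh.
Qed.

Theorem theorem4p16 (la : seq nat) (n : nat) :
  is_partition la -> sumn la <= n ->
  (CS_strongly_connected la n <-> exists w l : nat, la = nseq l w).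
Proof.
move=> Hpart Hsum; split; first exact: strongly_connected_rectangle.
move=> [w [l Ela]]; move: Hpart Hsum.
rewrite Ela sumn_nseq => /andP [_]; rewrite all_nseq => Hw Hsum.
(* Positive parts give [l <= w * l], hence [l <= n]. *)
apply: rectangle_strongly_connected => //; nia.
Qed.
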